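(* Let $h\in\{1,\tfrac32,2,\tfrac52,\dots\}$, $z=4h$, and let $E$, $V_{12}$, $S^\pm_{12}$ and $G_3\cong K_z$ be as in the context. Let $\mathbb{P}_{12}\subseteq\mathbb{R}^E$ be the polytope of all $x$ satisfying $\sum_{e\in p}\sigma^e_p x_e\le p^+-1$ for every signed polygon $(p,\sigma)\in S^\pm_{12}$, and $x_e\ge 0$ for all $e\in E$. Then $\mathbb{P}_{12}$ is a linear model for the MaxCut problem on $K_z$: the points of $\mathbb{P}_{12}$ with all coordinates integer are exactly the characteristic vectors of the coboundaries $\delta(W)$ ($W$ a set of vertices) of $K_z$.
   Context: Let $\omega=e^{2\pi i/z}$. The projective orbital graph $Pog_h$ is the graph cellularly embedded in the real projective plane $\mathbb{RP}^2$, viewed as a closed disk $D$ in the complex plane centered at $0$ with antipodal boundary points identified, defined as follows. Let $m=\lfloor h\rfloor$. Vertices: $k\omega^j$ for $k=1,\dots,m$, $j=0,\dots,z-1$, plus the vertex $0$ if $h$ is a half-integer. Edges: orbital edges $[k\omega^j,k\omega^{j+1}]$ (indices mod $z$); radial edges $[k\omega^j,(k+1)\omega^j]$ for $1\le k<m$; if $h$ is a half-integer, the $z$ edges $[0,\omega^j]$; and for each $j$ a segment from $m\omega^j$ to the boundary point of $D$ in direction $\omega^j$, where the segments at $j$ and $j+z/2$ join (through the antipodal identification) into a single edge between $m\omega^j$ and $m\omega^{j+z/2}$. $E$ is the edge set of $Pog_h$. A zigzag path of an embedded graph is a closed walk that at successive vertices alternately leaves along the edge immediately left and immediately right (in the local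 rotation) of the arriving edge. $Pog_h$ has exactly $z$ zigzag paths, each edge lies on exactly two distinct ones, and any two distinct ones share exactly one edge; so the graph $G_3$ with vertex set the zigzag paths of $Pog_h$ and edge set $E$, where $e$ joins the two zigzags through it, is the complete graph $K_z$, and $E$ is identified with the edge set of $K_z$. $V_{12}$ is the set of subsets $p\subseteq E$ that are either the set of edges incident to a vertex of $Pog_h$ of degree 3 or 4, or the set of boundary edges of a face of $Pog_h$ of length 3 or 4 (each is a triangle or quadrangle of $K_z$). $S^\pm_{12}$ is the set of pairs $(p,\sigma)$ with $p\in V_{12}$ and $\sigma:p\to\{+1,-1\}$, $e\mapsto\sigma^e_p$, such that the number $p^+$ of edges $e\in p$ with $\sigma^e_p=+1$ is odd. A coboundary $\delta(W)$ is the set of edges with exactly one end in $W$. *)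

(* Defs.v *)
From HB Require Import structures.
From mathcomp Require Import all_boot all_order all_algebra.
From mathcomp Require Import reals.

Set Implicit Arguments.
Unset Strict Implicit.
Unset Printing Implicit Defensive.

Import Order.TTheory GRing.Theory Num.Theory.
Local Open Scope ring_scope.

(** * Cellularly embedded graphs

   A graph cellularly embedded in a closed surface, orientable or not, given
   by a signed rotation system.  A half-edge (e, b) is the edge e seen from
   its end number b; [rot] is the counterclockwise rotation of the half-edges
   at each vertex for a chosen local orientation there; [twisted e] says that
   the local orientations at the two ends of e disagree along e. *)
Record embGraph := EmbGraph {
  vert : finType;
  edge : finType;
  org : edge * bool -> vert;
  rot : edge * bool -> edge * bool;
  twisted : edge -> bool;
  rot_inj : injective rot;
  rot_orbit : forall d d', fconnect rot d d' = (org d == org d')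
}.

Section EmbeddedGraph.
Variable G : embGraph.

Definition dart : finType := (edge G * bool)%type.

Definition opp_dart (d : dart) : dart := (d.1, ~~ d.2).

Definition degree (v : vert G) : nat := #|[set d : dart | org d == v]|.

Definition star (v : vert G) : {set edge G} :=
  [set d.1 | d : dart & org d == v].

(* (d, true), resp. (d, false): a walker about to traverse d from org d, whose
   next turn is to the left, resp. right, left and right being those of the
   local orientation at org d carried along d. *)
Definition flag : finType := (dart * bool)%type.

Definition flag_edge (f : flag) : edge G := f.1.1.

(* The direction of the upcoming turn in the local orientation at the vertex
   reached. *)
Definition arrival_turn (f : flag) : bool := f.2 (+) twisted (flag_edge f).

(* Arriving with the half-edge a behind, the edge immediately to the left is
   the clockwise neighbour of a, and the edge immediately to the right is its
   counterclockwise neighbour. *)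
Definition turn (left : bool) (a : dart) : dart :=
  if left then finv (@rot G) a else rot a.

(* A facial walk always turns to the same side. *)
Definition face_step (f : flag) : flag :=
  (turn (arrival_turn f) (opp_dart f.1), arrival_turn f).

Definition face_length (f : flag) : nat := order face_step f.

Definition face_edges (f : flag) : {set edge G} :=
  [set flag_edge g | g in fconnect face_step f].

(* A zigzag walk alternates between the two sides. *)
Definition zigzag_step (f : flag) : flag :=
  (turn (arrival_turn f) (opp_dart f.1), ~~ arrival_turn f).

(* The same zigzag traversed backwards: the walk that in state f has just
   turned at org f.1 to the side ~~ f.2; run backwards it turns there to the
   side f.2, which is f.2 (+) twisted when read at the other end of the edge. *)
Definition zigzag_rev (f : flag) : flag := (opp_dart f.1, arrival_turn f).

(* A zigzag path is a closed walk up to the choice of its starting point and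
   of its direction, recorded by the set of all its states. *)
Definition zigzag_of (f : flag) : {set flag} :=
  [set g | connect [rel x y | (y == zigzag_step x) || (y == zigzag_rev x)] f g].

Definition zigzags : {set {set flag}} := [set zigzag_of f | f : flag].

Definition zigzags_through (e : edge G) : {set {set flag}} :=
  [set Z in zigzags | [exists f in Z, flag_edge f == e]].

Definition V12 : {set {set edge G}} :=
  [set star v | v : vert G & (degree v == 3%N) || (degree v == 4%N)] :|:
  [set face_edges f | f : flag & (face_length f == 3%N) || (face_length f == 4%N)].

(* sigma : p -> {+1, -1} is given by a boolean function, true standing for +1;
   its values outside p are never used. *)
Definition plus_count (p : {set edge G}) (sigma : edge G -> bool) : nat :=
  #|[set e in p | sigma e]|.

Definition signed_polygon (p : {set edge G}) (sigma : edge G -> bool) : bool :=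
  (p \in V12) && odd (plus_count p sigma).

Section Polytope.
Variable R : realType.

Definition sign (b : bool) : R := if b then 1 else -1.

Definition P12 (x : {ffun edge G -> R}) : Prop :=
  (forall p sigma, signed_polygon p sigma ->
     \sum_(e in p) sign (sigma e) * x e <= (plus_count p sigma)%:R - 1) /\
  (forall e, 0 <= x e).

Definition integral_point (x : {ffun edge G -> R}) : Prop :=
  forall e, x e \is a Num.int.

Definition char_vec (A : {set edge G}) : {ffun edge G -> R} :=
  [ffun e => (e \in A)%:R].

End Polytope.
End EmbeddedGraph.

(** * Coboundaries of a complete graph *)

Definition complete_edges (T : finType) (V : {set T}) : {set {set T}} :=
  [set A : {set T} | (A \subset V) && (#|A| == 2%N)].

Definition complete_cobd (T : finType) (V W : {set T}) : {set {set T}} :=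
  [set A in complete_edges V | #|A :&: W| == 1%N].

(* The coboundary of W in the complete graph whose vertices are the zigzags,
   the edge e of G being identified with the pair of zigzags through it. *)
Definition zigzag_cobd (G : embGraph) (W : {set {set flag G}}) :
    {set edge G} :=
  [set e | zigzags_through e \in complete_cobd (zigzags G) W].

(** * The projective orbital graphs

   The parameter r : nat stands for h = 1 + r/2, so that h ranges over
   1, 3/2, 2, 5/2, ...; h is a half-integer (not an integer) iff r is odd. *)
Section Pog.
Variable r : nat.

Definition pog_m : nat := (r./2).+1.     (* floor h *)
Definition pog_z : nat := (r.+2 + r.+2)%N.   (* 4 h, as z/2 + z/2 *)

(* Orbit k j is the point (k+1) * omega^j. *)
Inductive pog_vert :=
  | Center of odd r
  | Orbit of 'I_pog_m & 'I_pog_z.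

(* Orbital k j joins Orbit k j to Orbit k (j+1); Radial k j joins Orbit k j to
   Orbit (k+1) j; Central j joins the center to Orbit 0 j; Cross j joins the
   outermost vertices in the directions j and j + z/2 through the boundary of
   the disk. *)
Inductive pog_edge :=
  | Orbital of 'I_pog_m & 'I_pog_z
  | Radial of 'I_(r./2) & 'I_pog_z
  | Central of odd r & 'I_pog_z
  | Cross of 'I_r.+2.

Definition pog_vert_code (v : pog_vert) :
    {_ : unit | odd r} + 'I_pog_m * 'I_pog_z :=
  match v with
  | Center o => inl (exist _ tt o)
  | Orbit k j => inr (k, j)
  end.

Definition pog_vert_decode (c : {_ : unit | odd r} + 'I_pog_m * 'I_pog_z) :=
  match c with
  | inl s => Center (svalP s)
  | inr (k, j) => Orbit k j
  end.

Lemma pog_vert_codeK : cancel pog_vert_code pog_vert_decode.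
Proof. by case=> //= o; congr Center; apply: bool_irrelevance. Qed.

HB.instance Definition _ := Equality.copy pog_vert (can_type pog_vert_codeK).
HB.instance Definition _ := Choice.copy pog_vert (can_type pog_vert_codeK).
HB.instance Definition _ := Countable.copy pog_vert (can_type pog_vert_codeK).
HB.instance Definition _ : isFinite pog_vert := CanIsFinite pog_vert_codeK.

Definition pog_edge_code (e : pog_edge) :
    ('I_pog_m * 'I_pog_z + 'I_(r./2) * 'I_pog_z) +
    ({_ : 'I_pog_z | odd r} + 'I_r.+2) :=
  match e with
  | Orbital k j => inl (inl (k, j))
  | Radial k j => inl (inr (k, j))
  | Central o j => inr (inl (exist _ j o))
  | Cross j => inr (inr j)
  end.

Definition pog_edge_decode
    (c : ('I_pog_m * 'I_pog_z + 'I_(r./2) * 'I_pog_z) +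
         ({_ : 'I_pog_z | odd r} + 'I_r.+2)) :=
  match c with
  | inl (inl (k, j)) => Orbital k j
  | inl (inr (k, j)) => Radial k j
  | inr (inl s) => Central (svalP s) (sval s)
  | inr (inr j) => Cross j
  end.

Lemma pog_edge_codeK : cancel pog_edge_code pog_edge_decode.
Proof. by case=> //= o j; congr Central; apply: bool_irrelevance. Qed.

HB.instance Definition _ := Equality.copy pog_edge (can_type pog_edge_codeK).
HB.instance Definition _ := Choice.copy pog_edge (can_type pog_edge_codeK).
HB.instance Definition _ := Countable.copy pog_edge (can_type pog_edge_codeK).
HB.instance Definition _ : isFinite pog_edge := CanIsFinite pog_edge_codeK.

Definition cross_end (j : 'I_r.+2) (b : bool) : 'I_pog_z :=
  if b then rshift r.+2 j else lshift r.+2 j.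

Definition pog_org (d : pog_edge * bool) : pog_vert :=
  match d with
  | (Orbital k j, b) => Orbit k (if b then ordS j else j)
  | (Radial k j, b) => Orbit (if b then lift ord0 k else lift ord_max k) j
  | (Central o j, b) => if b then Orbit ord0 j else Center o
  | (Cross j, b) => Orbit ord_max (cross_end j b)
  end.

(* The half-edges at Orbit k j, in counterclockwise order: outwards, along the
   orbit to j+1, inwards (absent if h is an integer and k = 0), along the orbit
   to j-1. *)
Definition out_dart (k : 'I_pog_m) (j : 'I_pog_z) : pog_edge * bool :=
  if unlift ord_max k is Some k' then (Radial k' j, false) else
  match split j with
  | inl i => (Cross i, false)
  | inr i => (Cross i, true)
  end.

Definition fwd_dart (k : 'I_pog_m) (j : 'I_pog_z) : pog_edge * bool :=
  (Orbital k j, false).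

Definition in_dart (k : 'I_pog_m) (j : 'I_pog_z) : option (pog_edge * bool) :=
  if unlift ord0 k is Some k' then Some (Radial k' j, true) else
  if @idP (odd r) is ReflectT o then Some (Central o j, true) else None.

Definition bwd_dart (k : 'I_pog_m) (j : 'I_pog_z) : pog_edge * bool :=
  (Orbital k (ord_pred j), true).

Definition pog_rot (d : pog_edge * bool) : pog_edge * bool :=
  match d with
  | (Orbital k j, false) => odflt (bwd_dart k j) (in_dart k j)
  | (Orbital k j, true) => out_dart k (ordS j)
  | (Radial k j, false) => fwd_dart (lift ord_max k) j
  | (Radial k j, true) => bwd_dart (lift ord0 k) j
  | (Central o j, false) => (Central o (ordS j), false)
  | (Central o j, true) => bwd_dart ord0 j
  | (Cross j, b) => fwd_dart ord_max (cross_end j b)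
  end.

(* Crossing the boundary of the disk reverses the orientation of the disk. *)
Definition pog_twisted (e : pog_edge) : bool :=
  if e is Cross _ then true else false.

Definition pog_rotV (d : pog_edge * bool) : pog_edge * bool :=
  match d with
  | (Orbital k j, false) => out_dart k j
  | (Orbital k j, true) => odflt (fwd_dart k (ordS j)) (in_dart k (ordS j))
  | (Radial k j, false) => bwd_dart (lift ord_max k) j
  | (Radial k j, true) => fwd_dart (lift ord0 k) j
  | (Central o j, false) => (Central o (ord_pred j), false)
  | (Central o j, true) => fwd_dart ord0 j
  | (Cross j, b) => bwd_dart ord_max (cross_end j b)
  end.

Lemma out_dart_max j b : out_dart ord_max (cross_end j b) = (Cross j, b).
Proof.
rewrite /out_dart unlift_none; case: b => /=.
  by rewrite (unsplitK (inr _ j)).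
by rewrite (unsplitK (inl _ j)).
Qed.

Lemma out_dartP k j :
  [/\ pog_rot (out_dart k j) = fwd_dart k j,
      pog_rotV (out_dart k j) = bwd_dart k j
    & pog_org (out_dart k j) = Orbit k j].
Proof.
rewrite /out_dart; case: unliftP => [k' ->|->] //.
by rewrite -[j in RHS]splitK -[j in bwd_dart _ j]splitK -[j in Orbit _ j]splitK;
  case: (split j).
Qed.

Lemma in_dart0 (o : odd r) j : in_dart ord0 j = Some (Central o j, true).
Proof.
rewrite /in_dart unlift_none.
by case: {-}_ / idP => // o'; rewrite (bool_irrelevance o' o).
Qed.

Lemma in_dartP k j :
  match in_dart k j with
  | Some (Radial k' j', true) => k = lift ord0 k' /\ j' = j
  | Some (Central _ j', true) => k = ord0 /\ j' = j
  | None => True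
  | _ => False
  end.
Proof. by rewrite /in_dart; case: unliftP => [k' ->|->] //; case: {-}_ / idP. Qed.

Lemma pog_rotK : cancel pog_rot pog_rotV.
Proof.
case=> [[k j|k j|o j|j] [] /=]; rewrite ?ord_predK ?ordSK //.
- by have [_ -> _] := out_dartP k (ordS j); rewrite /bwd_dart ordSK.
- have := in_dartP k j; case E: (in_dart k j) => [[[k1 j1|k1 j1|o j1|j1] []]|] //=.
  + by case=> -> ->.
  + by case=> -> ->.
  + by rewrite ord_predK E.
- by rewrite ?ord_predK /in_dart liftK.
- by rewrite /out_dart liftK.
- by rewrite ?ord_predK in_dart0.
- exact: (out_dart_max j true).
- exact: (out_dart_max j false).
Qed.

Lemma pog_rot_inj : injective pog_rot.
Proof. exact: can_inj pog_rotK. Qed.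

Lemma pog_org_rot d : pog_org (pog_rot d) = pog_org d.
Proof.
case: d => [[k j|k j|o j|j] [] /=]; rewrite ?ord_predK //.
- by have [_ _ ->] := out_dartP k (ordS j).
- have := in_dartP k j; case E: (in_dart k j) => [[[k1 j1|k1 j1|o j1|j1] []]|] //=.
  + by case=> -> ->.
  + by case=> -> ->.
  + by rewrite ord_predK.
Qed.

Definition base_dart (v : pog_vert) : pog_edge * bool :=
  match v with
  | Center o => (Central o ord0, false)
  | Orbit k j => fwd_dart k j
  end.

Lemma pog_base d : fconnect pog_rot d (base_dart (pog_org d)).
Proof.
have step e : fconnect pog_rot e (pog_rot e) by apply: fconnect1.
have bwd k j : fconnect pog_rot (Orbital k j, true) (fwd_dart k (ordS j)).
  apply: connect_trans (step _) _ => /=.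
  by have [<- _ _] := out_dartP k (ordS j).
case: d => [[k j|k j|o j|j] [] /=] //.
- apply: connect_trans (step _) _ => /=.
  by rewrite -[in fwd_dart _ j](ord_predK j); apply: bwd.
- apply: connect_trans (step _) _ => /=.
  by rewrite -[in fwd_dart _ j](ord_predK j); apply: bwd.
- rewrite (fconnect_sym pog_rot_inj).
  have -> : j = iter j (@ordS _) ord0.
    apply: val_inj; case: j => i /=; elim: i => [//|i IH] lti /=.
    by rewrite -IH ?modn_small // ltnW.
  elim: (val j) => [|i IH] //=.
  by apply: connect_trans IH (step (_, _)).
Qed.

Lemma pog_rot_orbit d d' :
  fconnect pog_rot d d' = (pog_org d == pog_org d').
Proof.
apply/idP/eqP => [/iter_findex <-|E].
  by elim: (findex _ _ _) => //= i ->; rewrite pog_org_rot.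
apply: connect_trans (pog_base d) _.
by rewrite E (fconnect_sym pog_rot_inj) pog_base.
Qed.

Definition Pog : embGraph :=
  @EmbGraph pog_vert pog_edge pog_org pog_rot pog_twisted
    pog_rot_inj pog_rot_orbit.

End Pog.

(* Main.v *)
(** Write z = 4h and number the zigzags by Z/z.  The edges of Pog_h at a given
   distance from the centre are exactly the pairs {a, a + d} for a fixed d, with
   d growing from 1 to z/2, and the vertices of degree 4 and quadrangular faces
   are the 4-cycles a, b, a + 1, b + 1; triangles are the case b = a + 1.

   An integral point x of the polytope is 0/1-valued and has even sum on every
   polygon of V_12.  Vanishing of the mixed differences
   x(a,b) + x(a+1,b) + x(a,b+1) + x(a+1,b+1) gives x(a,a+d) = S(a) + S(a+d),
   where S sums the values at d = 1, by induction on d.  At d = z/2 the edges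
   {a, a + z/2} and {a + z/2, a + z} coincide, which forces S(z) = 0, so S is a
   function on Z/z, i.e. on the zigzags.

   Conversely, around a vertex or a face each corner is passed by a single
   zigzag, so a coboundary meets every polygon of V_12 evenly. *)
Require Import Defs.
From HB Require Import structures.
From mathcomp Require Import all_boot all_order all_algebra.
From mathcomp Require Import reals.
From mathcomp Require Import zify lra.
(* [rot] and [rot_inj] also name constants of [seq]. *)
Import Defs.

Set Implicit Arguments.
Unset Strict Implicit.
Unset Printing Implicit Defensive.

Import Order.TTheory GRing.Theory Num.Theory.

(** * Parities of edge sets as exclusive-or sums *)

Lemma odd_card_big (T : finType) (A : {set T}) (F : pred T) :
  odd #|[set e in A | F e]| = \big[addb/false]_(e in A) F e.
Proof.
rewrite -sum1_card (big_morph odd oddD (erefl (odd 0))).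
rewrite big_mkcond /= [RHS]big_mkcond /=.
by apply: eq_bigr => e _; rewrite inE; case: (e \in A) => //=; case: (F e).
Qed.

Lemma big_fcycle (T : finType) (f : T -> T) (s : seq T) (F : pred T) x :
  fcycle f s -> uniq s -> x \in s ->
  \big[addb/false]_(y | fconnect f x y) F y = \big[addb/false]_(y <- s) F y.
Proof.
move=> cs us xs; rewrite big_uniq //; apply: eq_bigl => y.
by rewrite (fconnect_cycle cs xs).
Qed.

(** * Zigzags of an embedded graph and their coboundaries *)

Section Zigzags.
Variable G : embGraph.
Implicit Types (f g : flag G) (d : dart G) (e : edge G) (v : vert G).

Lemma opp_dartK : involutive (@opp_dart G).
Proof. by case=> e b; rewrite /opp_dart negbK. Qed.

Lemma zigzag_revK : involutive (@zigzag_rev G).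
Proof.
by case=> d t; rewrite /zigzag_rev /arrival_turn /flag_edge /= opp_dartK addbK.
Qed.

Lemma turnK t : cancel (@turn G t) (@turn G (~~ t)).
Proof.
by case: t => d; [apply: (f_finv (@rot_inj G)) | apply: (finv_f (@rot_inj G))].
Qed.

(* The zigzag through f passes the corner at org f.1 on the side f.2 of f.1;
   this is the state on the other edge of that corner, leaving org f.1. *)
Definition corner_flip f : flag G := (turn f.2 f.1, ~~ f.2).

Lemma corner_flipK : involutive corner_flip.
Proof. by case=> d t; rewrite /corner_flip /= turnK negbK. Qed.

Lemma zigzag_stepE f : zigzag_step f = corner_flip (zigzag_rev f).
Proof. by []. Qed.

Lemma face_step_flip f :
  face_step f = ((zigzag_step f).1, ~~ (zigzag_step f).2).
Proof. by rewrite /face_step /zigzag_step /= negbK. Qed.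

Lemma zigzag_step_inj : injective (@zigzag_step G).
Proof.
move=> f g; rewrite !zigzag_stepE.
by move/(inv_inj corner_flipK)/(inv_inj zigzag_revK).
Qed.

Lemma face_step_inj : injective (@face_step G).
Proof.
move=> f g; rewrite !face_step_flip => E; apply: zigzag_step_inj.
by move: E; case: (zigzag_step f) (zigzag_step g) => [d t] [d' t'];
  case=> -> /negb_inj ->.
Qed.

Definition zigzag_rel : rel (flag G) :=
  [rel x y | (y == zigzag_step x) || (y == zigzag_rev x)].

(** A step is a reversal followed by a corner flip, both involutions, so conjugating it by
    [zigzag_rev] inverts it. *)
Lemma zigzag_rel_sym : connect_sym zigzag_rel.
Proof.
have to_rev f : connect zigzag_rel f (zigzag_rev f).
  by apply: connect1; rewrite /zigzag_rel /= eqxx orbT.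
have to_step f : connect zigzag_rel f (zigzag_step f).
  by apply: connect1; rewrite /zigzag_rel /= eqxx.
have sub f g : connect zigzag_rel f g -> connect zigzag_rel g f.
  case/connectP=> p; elim: p f => [|h p IH] f /=; first by move=> _ ->.
  case/andP=> hfh /IH{}IH /IH{IH} con; apply: connect_trans con _.
  case/orP: hfh => /eqP ->; last by rewrite -{2}[f]zigzag_revK to_rev.
  apply: connect_trans (to_rev _) _; apply: connect_trans (to_step _) _.
  apply: connect_trans (to_rev _) _.
  by rewrite !zigzag_stepE zigzag_revK corner_flipK zigzag_revK.
by move=> f g; apply/idP/idP; apply: sub.
Qed.

Lemma zigzag_of_eq f g : (zigzag_of f == zigzag_of g) = connect zigzag_rel f g.
Proof.
apply/eqP/idP => [E|con].
  have : g \in zigzag_of g by rewrite inE connect0.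
  by rewrite -E inE.
apply/setP=> h; rewrite !inE; exact: (same_connect zigzag_rel_sym con).
Qed.

Lemma zigzag_of_rev f : zigzag_of (zigzag_rev f) = zigzag_of f.
Proof.
apply/esym/eqP; rewrite zigzag_of_eq; apply: connect1.
by rewrite /zigzag_rel /= eqxx orbT.
Qed.

Lemma zigzag_of_step f : zigzag_of (zigzag_step f) = zigzag_of f.
Proof.
by apply/esym/eqP; rewrite zigzag_of_eq; apply: connect1;
  rewrite /zigzag_rel /= eqxx.
Qed.

(** Both states sit at the corner between [d] and [rot d], and [corner_flip] exchanges them. *)
Lemma zigzag_of_rot d : zigzag_of (rot d, true) = zigzag_of (d, false).
Proof.
rewrite -(zigzag_of_rev (d, false)) -[RHS]zigzag_of_step zigzag_stepE.
by rewrite zigzag_revK.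
Qed.

(** Reversals and corner flips generate the zigzag relation. Invariants of both serve to separate
    zigzags and to define functions on them. *)
Lemma zigzag_constant (T : Type) (w : flag G -> T) :
  (forall f, w (zigzag_rev f) = w f) ->
  (forall d, w (rot d, true) = w (d, false)) ->
  forall f g, zigzag_of f = zigzag_of g -> w f = w g.
Proof.
move=> w_rev w_rot f g /eqP; rewrite zigzag_of_eq => /connectP[p].
have w_flip h : w (corner_flip h) = w h.
  case: h => d [] /=; rewrite /corner_flip /turn /=; last by rewrite w_rot.
  by rewrite -w_rot (f_finv (@rot_inj G)).
elim: p f => [|h p IH] f /=; first by move=> _ ->.
case/andP=> hfh /IH{}IH /IH <-; case/orP: hfh => /eqP -> //.
by rewrite zigzag_stepE w_flip.
Qed.

(** The four states on an edge form two pairs under reversal. *)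
Lemma flag_edge_zigzag e f : flag_edge f = e ->
  zigzag_of f \in [set zigzag_of ((e, false), true);
                       zigzag_of ((e, false), false)].
Proof.
case: f => -[e' b] t; rewrite /flag_edge /= => ->; rewrite !inE.
case: b; last by case: t; rewrite eqxx ?orbT.
rewrite -zigzag_of_rev /zigzag_rev /opp_dart /=.
by case: (arrival_turn _); rewrite eqxx ?orbT.
Qed.

Lemma zigzags_throughE e :
  zigzags_through e = [set zigzag_of ((e, false), true);
                           zigzag_of ((e, false), false)].
Proof.
apply/setP=> Z; apply/idP/idP.
  rewrite inE => /andP[/imsetP[g _ ->] /existsP[f /andP[]]].
  by rewrite inE -zigzag_of_eq => /eqP -> /eqP/flag_edge_zigzag.
have mem d t : d.1 = e -> zigzag_of (d, t) \in zigzags_through e.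
  move=> de; rewrite inE imset_f //=; apply/existsP; exists (d, t).
  by rewrite inE connect0 /flag_edge /= de eqxx.
by case/set2P=> ->; apply: mem.
Qed.

Hypothesis zigzags_distinct :
  forall d, zigzag_of (d, true) != zigzag_of (d, false).

Lemma mem_zigzag_cobd (W : {set {set flag G}}) e b t :
  (e \in zigzag_cobd W) =
  (zigzag_of ((e, b), t) \in W) (+) (zigzag_of ((e, b), ~~ t) \in W).
Proof.
rewrite inE zigzags_throughE.
have -> : (zigzag_of (e, b, t) \in W) (+) (zigzag_of (e, b, ~~ t) \in W) =
    (zigzag_of (e, false, true) \in W) (+) (zigzag_of (e, false, false) \in W).
  case: b; last by case: t; rewrite //= addbC.
  rewrite -zigzag_of_rev -(zigzag_of_rev (_, ~~ t)).
  rewrite /zigzag_rev /arrival_turn /flag_edge /opp_dart /=.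
  by case: t (twisted e) => [] [] //=; rewrite addbC.
set A := zigzag_of (e, false, true); set B := zigzag_of (e, false, false).
have neAB : A != B by apply: zigzags_distinct.
rewrite !inE subUset !sub1set !imset_f // cards2 neAB eqxx /=.
rewrite setIUl cardsU [_ :&: W :&: _](_ : _ = set0) ?cards0 ?subn0.
  have card1I C : #|[set C] :&: W| = (C \in W).
    case: (boolP (C \in W)) => CW.
      by rewrite (setIidPl _) ?cards1 ?sub1set.
    by rewrite (disjoint_setI0 _) ?cards0 // disjoints1.
  by rewrite !card1I; do 2 case: (_ \in W).
apply/setP=> C; rewrite !inE; apply/negP => /andP[/andP[/eqP -> _]].
by rewrite (negPf neAB).
Qed.

(** A fixed half-edge would have both its sides at one corner, hence on one zigzag. *)
Lemma rot_neq d : rot d != d.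
Proof.
apply: contraNneq (zigzags_distinct d) => rotd.
by rewrite -{1}rotd zigzag_of_rot.
Qed.

Lemma org_rot d : org (rot d) = org d.
Proof. by apply/esym/eqP; rewrite -rot_orbit fconnect1. Qed.

Lemma org_turn t d : org (turn t d) = org d.
Proof.
case: t; rewrite /turn ?org_rot //.
by rewrite -{2}[d](f_finv (@rot_inj G)) org_rot.
Qed.

Lemma turn_neq t d : turn t d != d.
Proof.
apply: contraNneq (rot_neq d); rewrite /turn; case: t => [E|->] //.
by rewrite -{1}E (f_finv (@rot_inj G)).
Qed.

(** * Edges met by a vertex or by a short face *)

Hypothesis loopless : forall d, org (opp_dart d) != org d.

Lemma same_edge_dart d d' : d.1 = d'.1 -> d = d' \/ d = opp_dart d'.
Proof.
case: d d' => [e b] [e' b'] /= <-.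
by case: b b' => [] []; [left | right | right | left].
Qed.

Lemma star_edge_inj v : {in [pred d : dart G | org d == v] &, injective fst}.
Proof.
move=> d d'; rewrite !inE => /eqP dv /eqP d'v /same_edge_dart[//|E].
by have := loopless d'; rewrite -E dv d'v eqxx.
Qed.

Lemma big_star v (F : pred (edge G)) :
  \big[addb/false]_(e in star v) F e = \big[addb/false]_(d | org d == v) F d.1.
Proof.
rewrite /star big_imset; first by apply: eq_bigl => d; rewrite inE.
by move=> d d'; rewrite !inE => dv d'v; apply: (@star_edge_inj v).
Qed.

Lemma card_star v : #|star v| = degree v.
Proof.
rewrite /star /degree card_in_imset ?cardsE //.
by move=> d d'; rewrite !inE => dv d'v; apply: (@star_edge_inj v).
Qed.

(** Repeating the half-edge would make the edge a loop; taking its opposite would mean that a turn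
    fixes a half-edge. *)
Lemma face_step_edge f : flag_edge (face_step f) != flag_edge f.
Proof.
apply/eqP=> /same_edge_dart[] /= E.
  by have := loopless f.1; rewrite -{2}E org_turn eqxx.
by have := turn_neq (arrival_turn f) (opp_dart f.1); rewrite E eqxx.
Qed.

Lemma zigzag_of_face_step f :
  zigzag_of ((face_step f).1, ~~ (face_step f).2) = zigzag_of f.
Proof. exact: zigzag_of_step. Qed.

(** Returning to the same half-edge with the other turning side would put both sides of the middle
    edge on one zigzag; returning to the opposite half-edge would make the middle edge a loop. *)
Lemma face_step2_edge f : face_step (face_step f) != f ->
  flag_edge (face_step (face_step f)) != flag_edge f.
Proof.
set f1 := face_step f; set f2 := face_step f1 => ne21.
have orgE (h : flag G) : org (face_step h).1 = org (opp_dart h.1) by rewrite org_turn.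
apply/eqP=> /same_edge_dart[] E.
  have E2 : f2.2 = ~~ f.2.
    apply: contra_neq_eq ne21; rewrite [f2]surjective_pairing E => ne.
    by rewrite [f in RHS]surjective_pairing; case: f2.2 f.2 ne => [] [].
  have := zigzag_of_face_step f1; rewrite -/f2 E E2 negbK -surjective_pairing.
  rewrite -(zigzag_of_face_step f) -/f1 => /eqP.
  by case: (f1) => d []; rewrite ?[_ == zigzag_of (d, true)]eq_sym
    (negPf (zigzags_distinct _)).
have := loopless f1.1; rewrite -[org (opp_dart _)]orgE -/f2 E -orgE.
by rewrite eqxx.
Qed.

(** Distinct states of such a walk are one or two steps apart in some cyclic direction, and the two
    preceding cases apply. Sums over the boundary edges thus become sums over states. *)
Lemma face_edge_inj f : face_length f <= 4 ->
  {in fconnect (@face_step G) f &, injective (@flag_edge G)}.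
Proof.
move=> len4 g h fg fh E; apply/eqP; apply: contraTT isT => neq.
have sym := fconnect_sym face_step_inj.
have gh : fconnect (@face_step G) g h.
  by apply: connect_trans fh; rewrite sym.
have ordg : order (@face_step G) g = face_length f.
  by apply: eq_card => k; rewrite /in_mem /= (same_connect sym fg).
have := findex_max gh; rewrite ordg.
have := iter_findex gh; move: (findex _ _ _) => i Ei lti.
have := iter_order face_step_inj g; rewrite ordg => gK.
have := leq_trans lti len4.
case: i Ei lti => [|[|[|[|//]]]] /= Ei lti _; last 1 first.
- have E4 : face_length f = 4 by apply/eqP; rewrite eqn_leq len4.
  rewrite E4 /= Ei in gK.
  by have := face_step_edge h; rewrite gK E eqxx.
- by rewrite Ei eqxx in neq.
- by have := face_step_edge g; rewrite Ei E eqxx.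
- by have := @face_step2_edge g; rewrite Ei E eqxx eq_sym => /(_ neq).
Qed.

Lemma big_face f (F : pred (edge G)) : face_length f <= 4 ->
  \big[addb/false]_(e in face_edges f) F e =
  \big[addb/false]_(g | fconnect (@face_step G) f g) F (flag_edge g).
Proof. by move=> len4; rewrite big_imset //; apply: face_edge_inj. Qed.

Lemma card_face f : face_length f <= 4 -> #|face_edges f| = face_length f.
Proof. by move=> len4; rewrite card_in_imset //; apply: face_edge_inj. Qed.

Lemma V12P (p : {set edge G}) : p \in V12 G ->
  (exists2 v, p = star v & degree v \in [:: 3; 4]) \/
  (exists2 f, p = face_edges f & face_length f \in [:: 3; 4]).
Proof.
rewrite inE => /orP[] /imsetP[y]; rewrite inE => h ->; [left|right];
  by exists y => //; rewrite !inE.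
Qed.

Lemma card_V12 (p : {set edge G}) : p \in V12 G -> #|p| \in [:: 3; 4].
Proof.
case/V12P=> -[y -> h]; first by rewrite card_star.
by rewrite card_face //; move: h; rewrite !inE => /orP[] /eqP ->.
Qed.

(* Each corner of a vertex or face is passed by one zigzag, which meets both
   edges of the corner; hence the labels cancel in pairs. *)
Lemma cobd_even (W : {set {set flag G}}) (p : {set edge G}) : p \in V12 G ->
  ~~ odd #|[set e in p | e \in zigzag_cobd W]|.
Proof.
move=> /V12P pV; rewrite odd_card_big.
case: pV => -[y -> h].
  rewrite big_star.
  under eq_bigr => d _ do
    rewrite [d.1 \in _](@mem_zigzag_cobd W _ d.2 true) -surjective_pairing.
  rewrite big_split /= [X in X (+) _](reindex_inj (@rot_inj G)) /=.
  under eq_bigl => d do rewrite org_rot.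
  by under eq_bigr => d _ do rewrite zigzag_of_rot; rewrite addbb.
rewrite big_face; last by move: h; rewrite !inE => /orP[] /eqP ->.
under eq_bigr => g _ do
  rewrite (@mem_zigzag_cobd W _ g.1.2 g.2) -surjective_pairing.
rewrite big_split /= [X in _ (+) X](reindex_inj face_step_inj) /=.
under [X in _ (+) X]eq_bigl => g do rewrite -(same_fconnect1_r face_step_inj).
under [X in _ (+) X]eq_bigr => g _ do rewrite zigzag_of_face_step.
by under eq_bigr => g _ do rewrite -surjective_pairing; rewrite addbb.
Qed.

End Zigzags.

(** * Integral points of the polytope and parity *)

Section Polytope.
Local Open Scope ring_scope.
Variables (G : embGraph) (R : realType).
Implicit Types (p A : {set edge G}) (x : {ffun edge G -> R}).

Lemma plus_countE p (sigma : pred (edge G)) :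
  (plus_count p sigma)%:R = \sum_(e in p) (sigma e)%:R :> R.
Proof.
rewrite /plus_count -sum1_card natr_sum big_mkcond [RHS]big_mkcond /=.
by apply: eq_bigr => e _; rewrite inE; case: (e \in p) => //=; case: (sigma e).
Qed.

(** An odd sign pattern differs from the even set [A] on [p] at some [e0]. The term at [e0] is one
    less than its share of [plus_count], and no other term exceeds its share. *)
Lemma char_vec_P12 A :
  (forall p, p \in V12 G -> ~~ odd #|[set e in p | e \in A]|) ->
  P12 (char_vec R A).
Proof.
move=> evenA; split=> [p sigma /andP[pV oddp]|e]; last by rewrite ffunE ler0n.
have /existsP[e0 /andP[e0p ne0]] : [exists e in p, sigma e != (e \in A)].
  apply: contraT; rewrite negb_exists => /forallP eqA.
  have /negP[] := evenA p pV.
  rewrite (_ : [set _ in _ | _] = [set e in p | sigma e]) //.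
  apply/setP=> e; rewrite !inE; have := eqA e; case: (e \in p) => //=.
  by rewrite negbK => /eqP ->.
rewrite plus_countE (bigD1 e0) //= [in leRHS](bigD1 e0) //= addrAC lerD //.
  rewrite ffunE; move: ne0; case: (sigma e0); case: (e0 \in A) => //= _;
    rewrite ?mulr0 ?mulr1 ?subrr ?sub0r //.
apply: ler_sum => e _; rewrite ffunE; case: (sigma e); case: (e \in A);
  by rewrite /= ?mulr0 ?mulr1 // lerN10.
Qed.

(** With [A] itself as sign pattern, the left-hand side would equal [plus_count]. *)
Lemma P12_char_vec_even A p : P12 (char_vec R A) -> p \in V12 G ->
  ~~ odd #|[set e in p | e \in A]|.
Proof.
case=> ineq _ pV; apply/negP=> oddp.
have := ineq p (mem A); rewrite /signed_polygon pV oddp => /(_ isT).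
rewrite leNgt => /negP[]; rewrite [ltRHS](_ : _ = (plus_count p (mem A))%:R).
  by rewrite gtrBl ltr01.
rewrite plus_countE; apply: eq_bigr => e _; rewrite ffunE /=.
by case: (e \in A); rewrite /= ?mulr0 ?mulr1.
Qed.

Lemma P12_integral_01 x p e : P12 x -> integral_point x -> p \in V12 G ->
  #|p| \in [:: 3; 4]%N -> e \in p -> x e = 0 \/ x e = 1.
Proof.
case=> ineq x_ge0 x_int pV cardp ep.
(* Add the inequalities whose positive set is [e] alone or a triple containing [e]: all other
   coordinates cancel, giving [x e <= 1] on a triangle and [x e <= 3/2] on a quadrangle. *)
have ub : x e < 2.
  have [s /= perm_s] : exists s, perm_eq (enum p) (e :: s).
    by exists (rem e (enum p)); apply: perm_to_rem; rewrite mem_enum.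
  have uniq_s : uniq (e :: s) by rewrite -(perm_uniq perm_s) enum_uniq.
  have {}ineq (sigma : pred (edge G)) : odd (count sigma (e :: s)) ->
      \sum_(f <- e :: s) sign R (sigma f) * x f <=
      (count sigma (e :: s))%:R - 1.
    have cnt : count sigma (e :: s) = plus_count p sigma.
      rewrite -(permP perm_s) /plus_count -size_filter cardE.
      apply/perm_size/uniq_perm => [||f]; rewrite ?enum_uniq //.
        by rewrite filter_uniq // enum_uniq.
      by rewrite mem_filter !mem_enum inE andbC.
    move=> odds; have := ineq p sigma; rewrite /signed_polygon pV -cnt odds.
    by move=> /(_ isT); rewrite -big_enum /= (perm_big _ perm_s).
  have := perm_size perm_s; rewrite -cardE => size_s.
  have {}ineq (t : seq (edge G)) := ineq (mem t).
  move: cardp (x_ge0 e); rewrite size_s !inE => /orP[] /eqP[];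
    case: s uniq_s {size_s perm_s} ineq => [|a [|b [|c []]]] //=;
    rewrite !inE ?negb_or !andbT.
    case/andP=> /andP[/negPf ea /negPf eb] /negPf ab ineq _.
    have := ineq [:: e]; have := ineq [:: e; a; b].
    rewrite !big_cons !big_nil /= !inE !eqxx !(eq_sym _ e) ea eb /= ?orbT /= ?natrD.
    by move=> /(_ isT) ? /(_ isT) ?; lra.
  case/and3P=> /and3P[/negPf ea /negPf eb /negPf ec] /andP[/negPf ab /negPf ac].
  move=> /negPf bc ineq _.
  have := ineq [:: e]; have := ineq [:: e; a; b].
  have := ineq [:: e; a; c]; have := ineq [:: e; b; c].
  rewrite !big_cons !big_nil /= !inE !eqxx !(eq_sym _ e) ea eb ec.
  rewrite !(eq_sym b a) !(eq_sym c a) !(eq_sym c b) ab ac bc /= ?orbT /= ?natrD.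
  by move=> /(_ isT) ? /(_ isT) ? /(_ isT) ? /(_ isT) ?; lra.
have := x_ge0 e; have /intrP[n E] := x_int e; move: ub; rewrite E.
rewrite -[2%R]/((2 : int)%:~R) ltr_int ler0z; case: n E => // -[|[|//]] _ _ _.
  by left.
by right.
Qed.
End Polytope.

(** * Labels of the zigzags of the projective orbital graph *)

Section PogLabels.
Variable r : nat.
Notation z := (pog_z r).
Notation m := (pog_m r).

Lemma pog_half : r.+2 = (pog_m r).*2 + odd r.
Proof. by rewrite /pog_m; have := odd_double_half r; lia. Qed.

(* Oriented counterclockwise, a zigzag first runs outwards, then crosses the
   boundary and runs inwards until it closes up.  Its label mod z is the
   direction from which the outward run starts: on that run the edges at orbit
   k in direction j have label j - k, up to rounding, and on the inward run
   j + k + 1 + odd r.  The summand z prevents truncation. *)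
Definition zigzag_label (f : flag (Pog r)) : nat :=
  let: (e, b, t) := f in
  match e with
  | Orbital k j => if t then j + k.+1 + odd r else j + z - k
  | Radial k j => if t then j + z - k.+1 else j + k.+1 + odd r
  | Central _ j => if t then (j : nat) else j.+1
  | Cross j => if t (+) b then j + z - m else j + m + odd r
  end.

Lemma label_rev f : zigzag_label (zigzag_rev f) = zigzag_label f.
Proof.
case: f => -[[k j|k j|o j|j] b] t;
  rewrite /zigzag_rev /arrival_turn /flag_edge /= ?addbF //.
by rewrite addbT addbN addNb negbK.
Qed.

Section Periodic.
Variables (T : Type) (S : nat -> T).
Hypothesis S_periodic : forall n, S (n + z) = S n.

Lemma periodic_mod a b : S (a %% z + b) = S (a + b).
Proof.
rewrite {2}(divn_eq a z); elim: (a %/ z) => [|q IH]; first by rewrite mul0n.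
by rewrite mulSn IH -S_periodic; congr S; lia.
Qed.

Lemma label_out k j t :
  S (zigzag_label (out_dart k j, t)) =
  S (if t then j + z - k.+1 else j + k.+1 + odd r).
Proof.
have halfE := pog_half; rewrite /out_dart; case: unliftP => [k' ->|->].
  by rewrite lift_max.
rewrite -[j in RHS]splitK; case: (split j) => i /=; rewrite ?addbT ?addbF.
  by case: t.
by case: t => /=; first rewrite -S_periodic; congr S;
  rewrite /pog_z; have := ltn_ord i; rewrite /pog_m in halfE *; lia.
Qed.

Lemma label_in k j t d : in_dart k j = Some d ->
  S (zigzag_label (d, t)) = S (if t then j + z - k else j + k + odd r).
Proof.
rewrite /in_dart; case: unliftP => [k' ->|->].
  by case=> <-; rewrite lift0.
case: {-}_ / idP => // o [<-] /=; case: t => /=; rewrite ?subn0 ?S_periodic //.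
by congr S; rewrite o; lia.
Qed.

(** Together with [label_rev], this makes the label an invariant of the zigzag up to multiples of
    [z]. The function [S] is abstract because it is used both for the residue mod [z] and for the
    potential. *)
Lemma label_rot (d : dart (Pog r)) :
  S (zigzag_label (rot d, true)) = S (zigzag_label (d, false)).
Proof.
have halfE := pog_half; have kz (k : 'I_m) : k < z.
  by have := ltn_ord k; rewrite /pog_z; lia.
case: d => -[k j|k j|o j|j] b; last 1 first.
- case: b => /=; congr S; have := ltn_ord j; rewrite /pog_z /pog_m in halfE *; lia.
- case: b.
    rewrite [LHS](label_out k (ordS j) true) /= -addnBA // periodic_mod.
    by congr S; have := kz k; lia.
  rewrite /rot /=.
  case E: (in_dart k j) => [d|] /=; first by rewrite (label_in true E).
  (* Without an inward edge, [k] is 0 and [h] is an integer: the rotation passes from the forward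
     orbital edge straight to the backward one. *)
  move: E; rewrite /in_dart; case: unliftP => [k' ->|->] //.
  case: {-}_ / idP => // /negP/negPf -> _ /=.
  by rewrite -addnA periodic_mod; congr S; have := ltn_ord j; lia.
- case: b; rewrite /rot /=.
    rewrite -addnA periodic_mod -[RHS]S_periodic; congr S.
    by rewrite /bump; have := ltn_ord j; lia.
  by congr S; rewrite /bump; have := ltn_ord k; lia.
- case: b; rewrite /rot /=.
    by rewrite -addnA periodic_mod -[RHS]S_periodic; congr S;
      rewrite o; have := ltn_ord j; lia.
  by rewrite -[_ %% _]addn0 periodic_mod addn0.
Qed.

End Periodic.

Lemma pog_loopless (d : dart (Pog r)) : org (opp_dart d) != org d.
Proof.
have orgE (e : edge (Pog r)) : org (e, true) != org (e, false).
  apply/eqP; case: e => [k j|k j|o j|j] //= [].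
  - move/eqP; rewrite -val_eqE /=; have := ltn_ord j.
    rewrite leq_eqVlt => /orP[/eqP jz|lt]; last by rewrite modn_small //; lia.
    by rewrite jz modnn; move: jz; rewrite /pog_z; lia.
  - by rewrite /bump; have := ltn_ord k; lia.
  - by lia.
by case: d => e []; rewrite /opp_dart /= ?orgE // eq_sym orgE.
Qed.

Lemma mod_shift_neq a c : 0 < c < z -> a %% z != (a + c) %% z.
Proof.
by case/andP=> c0 cz; rewrite -{1}[a]addn0 eqn_modDl mod0n modn_small; lia.
Qed.

(** On one edge the two labels differ mod [z] by [2k + 1 + odd r] (orbital), [2k + 2 + odd r]
    (radial), 1 (central) or [z/2] (crossing), up to sign, and none of these is 0 mod [z]. *)
Lemma pog_zigzags_distinct (d : dart (Pog r)) :
  zigzag_of (d, true) != zigzag_of (d, false).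
Proof.
have per n : (n + z) %% z = n %% z by rewrite modnDr.
have rev f := congr1 (modn^~ z) (@label_rev f).
apply/eqP => /(zigzag_constant rev (label_rot per)).
have halfE := pog_half; apply/eqP; case: d => -[k j|k j|o j|j] b /=.
- rewrite eq_sym -[X in _ != X]per.
  have -> : j + k.+1 + odd r + z = j + z - k + (k.*2.+1 + odd r).
    by have := ltn_ord k; rewrite /pog_z; lia.
  by apply: mod_shift_neq; have := ltn_ord k; rewrite /pog_z; lia.
- rewrite -[X in _ != X]per.
  have -> : j + k.+1 + odd r + z = j + z - k.+1 + (k.*2.+2 + odd r).
    by have := ltn_ord k; rewrite /pog_z /pog_m in halfE *; lia.
  by apply: mod_shift_neq; have := ltn_ord k;
     rewrite /pog_z /pog_m in halfE *; lia.
- by rewrite -addn1; apply: mod_shift_neq; rewrite /pog_z; lia.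
have neq : (j + z - m) %% z != (j + m + odd r) %% z.
  rewrite -[X in _ != X]per.
  have -> : j + m + odd r + z = j + z - m + r.+2 by rewrite /pog_z; lia.
  by apply: mod_shift_neq; rewrite /pog_z; lia.
by case: b => //=; rewrite eq_sym.
Qed.

End PogLabels.

(** * Parity relations at vertices and faces *)

Section PogPolygons.
Variable r : nat.
Notation z := (pog_z r).
Notation m := (pog_m r).

Definition orbit_darts (k : 'I_m) (j : 'I_z) : seq (dart (Pog r)) :=
  [:: out_dart k j, fwd_dart k j &
      rcons (seq_of_opt (in_dart k j)) (bwd_dart k j)].

Lemma orbit_darts_cycle k j : fcycle (@rot (Pog r)) (orbit_darts k j).
Proof.
have [rot_out _ _] := out_dartP k j.
have rot_in := in_dartP k j.
rewrite /orbit_darts; case E: (in_dart k j) rot_in => [d|] /= rot_in;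
  rewrite rot_out E /= ord_predK ?eqxx //.
by move: rot_in; case: (d) => -[k' j'|k' j'|o j'|j'] [] //= [-> ->]; rewrite !eqxx.
Qed.

Lemma orbit_darts_uniq k j : uniq (orbit_darts k j).
Proof.
rewrite /orbit_darts /out_dart; have := in_dartP k j.
case: (in_dart k j) => [[[k' j'|k' j'|o j'|j'] []]|] //= _;
  case: (unlift _ _) => [k''|] /=; try case: (split j) => i;
  by rewrite !inE /fwd_dart /bwd_dart !xpair_eqE /= ?andbF.
Qed.

Lemma orbit_dartsP k j (d : dart (Pog r)) :
  (org d == Orbit k j) = fconnect (@rot (Pog r)) (out_dart k j) d.
Proof.
by rewrite rot_orbit eq_sym /=; have [_ _ ->] := out_dartP k j.
Qed.

Lemma degree_orbit k j : degree (Orbit k j : vert (Pog r)) \in [:: 3; 4].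
Proof.
rewrite /degree (_ : #|_| = size (orbit_darts k j)).
  by rewrite /orbit_darts; case: (in_dart k j).
rewrite -(order_cycle (orbit_darts_cycle k j) (orbit_darts_uniq k j) (mem_head _ _)).
by apply: eq_card => d; rewrite !inE orbit_dartsP.
Qed.

Lemma star_orbit_V12 k j : star (Orbit k j : vert (Pog r)) \in V12 (Pog r).
Proof.
by rewrite inE imset_f // inE; have := degree_orbit k j; rewrite !inE.
Qed.

(** The end [true] of any edge lies on an orbit. Hence every coordinate occurs in some polygon
    inequality. *)
Lemma edge_in_star_orbit (e : edge (Pog r)) :
  exists k j, e \in star (Orbit k j : vert (Pog r)).
Proof.
have mem (b : bool) k j : pog_org (e, b) = Orbit k j ->
    exists k j, e \in star (Orbit k j : vert (Pog r)).
  by move=> E; exists k, j; apply/imsetP; exists (e, b); rewrite // inE; apply/eqP.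
by case: e mem => [k j|k j|o j|j] mem; apply: (mem true).
Qed.

Variable y : pred (edge (Pog r)).
Hypothesis y_even :
  forall p, p \in V12 (Pog r) -> ~~ odd #|[set e in p | y e]|.

Definition out_val k j : bool := y (out_dart k j).1.
(** The default [false] lets one parity relation cover vertices of degree 3 and 4. *)
Definition in_val k j : bool := if in_dart k j is Some d then y d.1 else false.
Definition orb_val k j : bool := y (Orbital k j).

Lemma even_star k j :
  out_val k j = orb_val k j (+) in_val k j (+) orb_val k (ord_pred j).
Proof.
have /negPf := y_even (star_orbit_V12 k j).
rewrite odd_card_big big_star; last exact: pog_loopless.
under eq_bigl => d do rewrite orbit_dartsP.
rewrite (big_fcycle _ (orbit_darts_cycle k j) (orbit_darts_uniq k j)) ?mem_head //.
rewrite /orbit_darts /in_val /out_val /orb_val.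
case: (in_dart k j) => [d|]; rewrite !big_cons big_nil /= !addbF.
  by case: (y _) (y _) (y _) (y _) => [] [] [] [].
by case: (y _) (y _) (y _) => [] [] [].
Qed.

Lemma even_face_cycle (s : seq (flag (Pog r))) :
  fcycle (@face_step (Pog r)) s -> uniq s -> size s \in [:: 3; 4] ->
  \big[addb/false]_(f <- s) y (flag_edge f) = false.
Proof.
case: s => // f s cs us size_s.
have len : face_length f = size (f :: s) by apply: order_cycle; rewrite ?mem_head.
have V : face_edges f \in V12 (Pog r).
  rewrite inE orbC imset_f // inE len; by move: size_s; rewrite !inE.
rewrite -(big_fcycle (fun f => y (flag_edge f)) cs us (mem_head f s)).
have /negPf := y_even V; rewrite odd_card_big big_face //.
- exact: pog_zigzags_distinct.
- exact: pog_loopless.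
- by rewrite len; move: size_s; rewrite !inE => /orP[] /eqP ->.
Qed.

Lemma even_face (k : 'I_(r./2)) j :
  orb_val (lift ord0 k) j =
  orb_val (lift ord_max k) j (+) y (Radial k (ordS j)) (+) y (Radial k j).
Proof.
have := @even_face_cycle
  [:: ((Orbital (lift ord_max k) j, false), false);
      ((Radial k (ordS j), false), false);
      ((Orbital (lift ord0 k) j, true), false);
      ((Radial k j, true), false)].
rewrite !big_cons big_nil !addbF /flag_edge /orb_val => E.
have {E} : y (Orbital (lift ord_max k) j) (+) (y (Radial k (ordS j)) (+)
   (y (Orbital (lift ord0 k) j) (+) y (Radial k j))) = false.
  apply: E => //; rewrite /face_step /arrival_turn /flag_edge /=.
    rewrite /in_dart /out_dart !liftK /=.
    by rewrite /bwd_dart /fwd_dart ordSK !eqxx.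
  by rewrite !inE !xpair_eqE /= ?andbF.
by case: (y _) (y _) (y _) (y _) => [] [] [] [].
Qed.

Lemma even_triangle j : odd r ->
  orb_val ord0 j = in_val ord0 j (+) in_val ord0 (ordS j).
Proof.
move=> o; rewrite /in_val !in_dart0 /orb_val /=.
have := @even_face_cycle
  [:: ((Central o j, true), false); ((Central o (ordS j), false), false);
      ((Orbital ord0 j, true), false)].
rewrite !big_cons big_nil !addbF /flag_edge => E.
have {E} : y (Central o j) (+)
    (y (Central o (ordS j)) (+) y (Orbital ord0 j)) = false.
  apply: E => //; rewrite /face_step /arrival_turn /flag_edge /=.
    by rewrite in_dart0 /bwd_dart ordSK !eqxx.
  by rewrite !inE !xpair_eqE /= ?andbF.
by case: (y _) (y _) (y _) => [] [] [].
Qed.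

(** * The potential and its periodicity *)

Lemma pog_z_gt0 : 0 < z. Proof. by []. Qed.

Definition dir (n : nat) : 'I_z := Ordinal (ltn_pmod n pog_z_gt0).

Lemma ordS_dir n : ordS (dir n) = dir n.+1.
Proof. by apply: val_inj; rewrite /= -addn1 modnDml addn1. Qed.

Lemma ord_pred_dir n : ord_pred (dir n.+1) = dir n.
Proof. by rewrite -ordS_dir ordSK. Qed.

Lemma dirD n : dir (n + z) = dir n.
Proof. by apply: val_inj; rewrite /= modnDr. Qed.

Lemma dir_ord (j : 'I_z) : dir j = j.
Proof. by apply: val_inj; rewrite /= modn_small. Qed.

(** The value on the pair of zigzags labelled [n] and [n + 1]. These pairs are the central edges if
    [h] is a half-integer, and the innermost orbital edges otherwise. *)
Definition step_val (n : nat) : bool :=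
  if odd r then in_val ord0 (dir n) else orb_val ord0 (dir n).

(** Defined on natural numbers, since periodicity is only obtained at the boundary of the disk. *)
Definition potential (n : nat) : bool := \big[addb/false]_(i < n) step_val i.

Lemma potential0 : potential 0 = false.
Proof. by rewrite /potential big_ord0. Qed.

Lemma potentialS n : potential n.+1 = potential n (+) step_val n.
Proof. by rewrite /potential big_ord_recr. Qed.

(** In the vertex relation at direction [n + k + 1], the potentials at [n + 1] and at
    [n + 2k + 1 + odd r] cancel. *)
Lemma out_val_potential k :
  (forall n, orb_val k (dir (n + k)) =
     potential n (+) potential (n + k.*2.+1 + odd r)) ->
  (forall n, in_val k (dir (n + k)) =
     potential n (+) potential (n + k.*2 + odd r)) ->
  forall n, out_val k (dir (n + k.+1)) =
     potential n (+) potential (n + k.*2.+2 + odd r).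
Proof.
move=> orbE inE n; rewrite even_star addnS ord_pred_dir -addSn orbE inE orbE.
rewrite !addSn !addnS !addSn.
by do 4 case: (potential _).
Qed.

(** Induction outwards from the centre: vertices give the next radial edges, then quadrangular faces
    give the next orbit. Here [n] is the label of the outward run, which meets orbit [k] in
    direction [n + k]. *)
Lemma orb_in_val_potential k :
  (forall n, orb_val k (dir (n + k)) =
     potential n (+) potential (n + k.*2.+1 + odd r)) /\
  (forall n, in_val k (dir (n + k)) =
     potential n (+) potential (n + k.*2 + odd r)).
Proof.
have [i] := ubnP (k : nat); elim: i k => // i IH k ki.
case: (unliftP ord0 k) ki => [k' ->|->] ki; last first.
  (* Innermost orbit: for integer [h] the value [false] of [in_val] agrees with two equal
     potentials; for half-integer [h] the central triangles then give the orbital edges. *)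
  have inE n : in_val ord0 (dir n) = potential n (+) potential (n + odd r).
    case: (boolP (odd r)) => o.
      by rewrite addn1 potentialS /step_val o addbA addbb.
    rewrite addn0 addbb /in_val /in_dart unlift_none.
    by case: {-}_ / idP => // o'; rewrite o' in o.
  split=> n; rewrite !addn0 // ; case: (boolP (odd r)) => o.
    by rewrite even_triangle // ordS_dir !inE o !addn1 -addbA addKb.
  by rewrite addn0 addn1 potentialS /step_val (negPf o) addbA addbb.
have ki' : lift ord_max k' < i by move: ki; rewrite lift0 lift_max.
have [orbE inE] := IH _ ki'.
(* The outward edge of one orbit is the inward edge of the next. *)
have radE n : y (Radial k' (dir (n + k'.+1))) =
    potential n (+) potential (n + k'.*2.+2 + odd r).
  have := out_val_potential orbE inE n.
  by rewrite /out_val /out_dart liftK lift_max.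
rewrite lift0; split=> n; last first.
  by rewrite /in_val /in_dart liftK /= radE.
rewrite even_face ordS_dir -addSn !radE [in orb_val _ _]addnS -addSn.
rewrite -[in orb_val _ _](lift_max k') orbE lift_max doubleS.
rewrite !addSn !addnS !addSn.
by do 4 case: (potential _).
Qed.

(** The crossing edge in directions [m] and [m + z/2] is read from both ends: its value is the sum
    of the potentials at 0 and [z/2], and also of those at [z/2] and [z]. *)
Lemma potential_z : potential z = false.
Proof.
have halfE := pog_half r.
have [orbE inE] := orb_in_val_potential ord_max.
have outE n := out_val_potential orbE inE n.
have mr : m < r.+2 by rewrite /pog_m in halfE *; lia.
have out0 : out_val ord_max (dir m) = y (Cross (Ordinal mr)).
  rewrite /out_val (_ : dir m = cross_end (Ordinal mr) false) ?out_dart_max //.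
  by apply: val_inj; rewrite /= modn_small // /pog_z; lia.
have out1 : out_val ord_max (dir (r.+2 + m)) = y (Cross (Ordinal mr)).
  rewrite /out_val (_ : dir _ = cross_end (Ordinal mr) true) ?out_dart_max //.
  by apply: val_inj; rewrite /= modn_small // /pog_z; lia.
have := outE 0; have := outE r.+2; rewrite /= -/m out0 out1 => ->.
rewrite add0n (_ : (r./2).*2.+2 = m.*2) // -!addnA -halfE -/z.
rewrite potential0.
by case: (potential _) (potential _) => [] [].
Qed.

Lemma potentialD n : potential (n + z) = potential n.
Proof.
elim: n => [|n IH]; first by rewrite add0n potential_z potential0.
by rewrite addSn !potentialS IH /step_val dirD.
Qed.

(** Passes from labels back to directions by taking [n = j + z - k], for which [n + k] is [j] mod
    [z]; the two potentials are then those of the zigzags through [e]. *)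
Lemma label_potential (e : edge (Pog r)) b :
  y e = potential (zigzag_label ((e, b), true)) (+)
        potential (zigzag_label ((e, b), false)).
Proof.
have halfE := pog_half r.
have kz (k : 'I_m) : k < z by have := ltn_ord k; rewrite /pog_z; lia.
have [orbE inE] : (forall k n, orb_val k (dir (n + k)) =
     potential n (+) potential (n + k.*2.+1 + odd r)) /\
  (forall k n, in_val k (dir (n + k)) =
     potential n (+) potential (n + k.*2 + odd r)).
  by split=> k; have [] := orb_in_val_potential k.
case: e => [k j|k j|o j|j] /=.
- have := orbE k (j + z - k); rewrite subnK; last by have := kz k; lia.
  rewrite dirD dir_ord /orb_val => ->; rewrite addbC; congr addb.
  by rewrite -[RHS]potentialD; congr potential; have := kz k; lia.
- have := inE (lift ord0 k) (j + z - k.+1); rewrite lift0.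
  have := kz (lift ord0 k); rewrite lift0 => kz'.
  rewrite subnK; last by lia.
  rewrite dirD dir_ord /in_val /in_dart liftK /= => ->; congr addb.
  by rewrite -[RHS]potentialD; congr potential; lia.
- have := inE ord0 j; rewrite addn0 dir_ord /in_val (in_dart0 o) /= => ->.
  by congr (_ (+) potential _); rewrite o; lia.
have := out_val_potential (orbE ord_max) (inE ord_max) (j + z - m).
rewrite subnK; last by rewrite /pog_z /= in halfE *; lia.
rewrite (_ : dir _ = cross_end j false); last first.
  by apply: val_inj; rewrite /= modnDr modn_small // /pog_z; have := ltn_ord j; lia.
rewrite /out_val out_dart_max /= => ->.
have -> : potential (j + z - m + (r./2).*2.+2 + odd r) = potential (j + m + odd r).
  rewrite -[RHS]potentialD; congr potential; rewrite /pog_z /pog_m in halfE *; lia.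
by case: b => //=; rewrite addbC.
Qed.

End PogPolygons.

(** * Integral points and coboundaries *)

Theorem mainTheorem6 (R : realType) (r : nat) (x : {ffun edge (Pog r) -> R}) :
  (P12 x /\ integral_point x) <->
  exists W : {set {set flag (Pog r)}},
    W \subset zigzags (Pog r) /\ x = char_vec R (zigzag_cobd W).
Proof.
have distinct := @pog_zigzags_distinct r; have loopless := @pog_loopless r.
split=> [[xP x_int]|[W [_ ->]]]; last first.
  split; first by apply: char_vec_P12 => p; apply: cobd_even.
  by move=> e; rewrite ffunE natr_int.
pose A := [set e | x e == 1%R].
have xE : x = char_vec R A.
  apply/ffunP=> e; rewrite ffunE inE.
  have [k [j ekj]] := edge_in_star_orbit e.
  have V := star_orbit_V12 k j.
  have [->|->] := P12_integral_01 xP x_int V (card_V12 distinct loopless V) ekj.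
    by rewrite eq_sym oner_eq0.
  by rewrite eqxx.
rewrite xE in xP *.
pose S := potential (mem A).
have even p := P12_char_vec_even xP (p := p).
have SD := potentialD even.
(* One state with true potential suffices, because the potential of the label is constant along a
   zigzag. *)
pose W := [set Z in zigzags (Pog r) | [exists f in Z, S (zigzag_label f)]].
have memW f : (zigzag_of f \in W) = S (zigzag_label f).
  rewrite inE imset_f //=; apply/existsP/idP => [[g]|Sf]; last first.
    by exists f; rewrite inE connect0.
  rewrite inE -zigzag_of_eq => /andP[/eqP fg].
  have S_rev g := congr1 S (@label_rev r g).
  by rewrite (zigzag_constant S_rev (label_rot SD) fg).
exists W; split; first by apply/subsetP=> Z; rewrite inE => /andP[].
congr (char_vec R _); apply/setP=> e.
rewrite (mem_zigzag_cobd distinct W e false true) !memW.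
exact: label_potential.
Qed.
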